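(* The resolving total domination number of the fractal cubic network $FCN(1)$ is $\gamma_{rt}(FCN(1)) = 8$.
   Context: Fractal cubic network: for an integer $l\ge 0$, $FCN(l)$ is the finite simple graph whose vertices are all binary strings of length $2l+2$, defined recursively as follows. $FCN(0)$ is the 4-cycle with vertices $00, 01, 11, 10$ in this cyclic order. For $l\ge 1$, $FCN(l)$ is obtained from the disjoint union of the four copies $ab\,\Vert\,FCN(l-1)$, $a,b\in\{0,1\}$ (each vertex string of $FCN(l-1)$ is prefixed by $ab$, adjacency inside a copy being that of $FCN(l-1)$), by adding the four edges $\{00w,10w\}$, $\{10w,11w\}$, $\{11w,01w\}$, $\{01w,00w\}$, where $w=10(01)^{l-1}$ is the string $10$ followed by $l-1$ repetitions of $01$. A set $R\subseteq V(\Gamma)$ of a connected graph $\Gamma$ is a resolving set if for every two distinct vertices $g,h$ there is $r\in R$ with $d(g,r)\ne d(h,r)$ (graph distance). A total dominating set is a set $D\subseteq V(\Gamma)$ such that every vertex of $\Gamma$ (including those in $D$) is adjacent to some vertex of $D$. A resolving total dominating set is a set that is both a resolving set and a total dominating set; $\gamma_{rt}(\Gamma)$ is the minimum size of such a set. *)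

(* Defs.v *)
From mathcomp Require Import all_boot.

Set Implicit Arguments.
Unset Strict Implicit.
Unset Printing Implicit Defensive.

(* A finite simple graph is given by a symmetric irreflexive relation e on a
   finType T. *)
Section GraphInvariants.

Variables (T : finType) (e : rel T).

Definition walk_of_length (x y : T) (n : nat) : bool :=
  [exists p : n.-tuple T, path e x p && (last x p == y)].

(* Vertices of the same component are joined by a walk of length < #|T|;
   vertices of distinct components get the junk value #|T|. *)
Definition gdist (x y : T) : nat := find (walk_of_length x y) (iota 0 #|T|).

Definition resolving (R : {set T}) : bool :=
  [forall g, forall h, (g != h) ==>
     [exists r in R, gdist g r != gdist h r]].

Definition total_dominating (D : {set T}) : bool :=
  [forall x, exists y in D, e x y].

Definition resolving_total_dominating (D : {set T}) : bool :=
  resolving D && total_dominating D.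

(* The full vertex set is resolving total dominating as soon as some set is
   (no isolated vertex); otherwise the value is junk. *)
Definition gamma_rt : nat :=
  #|[arg min_(D < [set: T] | resolving_total_dominating D) #|D|]|.

Lemma gdist_le_walk (x y : T) (p : seq T) :
  path e x p -> last x p = y -> gdist x y <= size p.
Proof.
move=> ep lp; case: (ltnP (size p) #|T|) => [pT | Tp]; last first.
  by apply: leq_trans (find_size _ _) _; rewrite size_iota.
rewrite leqNgt; apply/negP => /(before_find 0); rewrite nth_iota // add0n.
by move/negbT/negP; apply; apply/existsP; exists (in_tuple p);
  rewrite /= ep lp eqxx.
Qed.

Lemma gdist_walk (x y : T) : connect e x y ->
  exists2 p, path e x p /\ last x p = y & size p = gdist x y.
Proof.
case/connectP => p0 ep0 lp0; have hw : has (walk_of_length x y) (iota 0 #|T|).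
  case: (shortenP ep0) lp0 => p ep up _ lp.
  have pT : size p < #|T|
    by have := max_card (mem (x :: p)); rewrite (card_uniqP up).
  apply/hasP; exists (size p); first by rewrite mem_iota.
  by apply/existsP; exists (in_tuple p); rewrite /= ep lp eqxx.
have dT : gdist x y < #|T| by rewrite -[X in _ < X](size_iota 0) -has_find.
have := nth_find 0 hw; rewrite -/(gdist x y) nth_iota // add0n.
by case/existsP => p /andP[ep /eqP lp]; exists p; rewrite ?size_tuple.
Qed.

Lemma resolving_total_dominatingT :
  (forall x, exists y, e x y) -> resolving_total_dominating [set: T].
Proof.
move=> noiso; have dxx x : gdist x x = 0.
  by apply/eqP; rewrite -leqn0 (@gdist_le_walk x x [::]).
apply/andP; split; last first.
  by apply/forallP => x; case: (noiso x) => y exy; apply/existsP; exists y;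
     rewrite inE.
apply/forallP => g; apply/forallP => h; apply/implyP => gh; apply/existsP.
exists g; rewrite inE dxx /=; apply: contraNN gh => /eqP d0.
have T0 : 0 < #|T| by apply/card_gt0P; exists g.
have hf : has (walk_of_length h g) (iota 0 #|T|).
  by rewrite has_find size_iota -/(gdist h g) -d0.
have := nth_find 0 hf; rewrite -/(gdist h g) -d0 nth_iota // addn0.
by case/existsP => p; rewrite (tuple0 p) /= eq_sym.
Qed.

End GraphInvariants.

Definition square : seq (seq bool) :=
  [:: [:: false; false]; [:: false; true]; [:: true; true]; [:: true; false]].

Definition square_adj : rel (seq bool) :=
  fun u v => (u \in square) && ((v == next square u) || (v == prev square u)).

(* 10 followed by n repetitions of 01 *)
Definition junction (n : nat) : seq bool :=
  [:: true; false] ++ flatten (nseq n [:: false; true]).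

(* The four edges added at each level join the prefixes 00, 10, 11, 01 in this
   cyclic order, which is the cycle of FCN(0) traversed backwards. *)
Fixpoint fcn_seq_adj (l : nat) (u v : seq bool) : bool :=
  if l is n.+1 then
    (take 2 u == take 2 v) && fcn_seq_adj n (drop 2 u) (drop 2 v)
    || [&& drop 2 u == junction n, drop 2 v == junction n
         & square_adj (take 2 u) (take 2 v)]
  else square_adj u v.

Definition FCN_vertex (l : nat) : finType := (2 * l + 2).-tuple bool.

Definition FCN (l : nat) : rel (FCN_vertex l) := fun u v => fcn_seq_adj l u v.

Arguments FCN : clear implicits.

Lemma square_adj_sym : symmetric square_adj.
Proof.
suff adj u v : square_adj u v -> square_adj v u.
  by move=> u v; apply/idP/idP; apply: adj.
case/andP; rewrite !inE.
by case/or4P => /eqP-> /orP[] /eqP->.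
Qed.

Lemma square_adj_irr : irreflexive square_adj.
Proof.
move=> u; apply/negP => /andP[]; rewrite !inE.
by case/or4P => /eqP->.
Qed.

Lemma fcn_seq_adj_sym l : symmetric (fcn_seq_adj l).
Proof.
elim: l => [|l IH] u v /=; first exact: square_adj_sym.
by rewrite eq_sym IH square_adj_sym [X in _ || X]andbCA.
Qed.

Lemma fcn_seq_adj_irr l : irreflexive (fcn_seq_adj l).
Proof.
elim: l => [|l IH] u /=; first exact: square_adj_irr.
by rewrite IH square_adj_irr !andbF.
Qed.

Lemma FCN_sym l : symmetric (FCN l).
Proof. by move=> u v; apply: fcn_seq_adj_sym. Qed.

Lemma FCN_irr l : irreflexive (FCN l).
Proof. by move=> u; apply: fcn_seq_adj_irr. Qed.

(* Main.v *)
Require Import Defs.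
From mathcomp Require Import all_boot.

(** FCN(1) is a central 4-cycle on the vertices [ab10], each of which carries a
    pendant 4-cycle [ab || FCN(0)].  Three vertices of each pendant cycle have
    no neighbour outside it, so total domination alone forces one vertex of each
    parity in each of the four copies, hence at least 8 vertices.  Conversely the
    8 vertices [abc0] are enough: the distances to the central cycle determine
    the copy and the distance to its attaching vertex, and [ab00] separates its
    twin [ab11] from itself. *)

(** Changing by at most one along edges bounds [f] by the length of any walk to [y]; repeated
    descent produces a walk of length exactly [f x]. *)
Lemma gdist_eq (T : finType) (e : rel T) (y : T) (f : T -> nat) :
  f y = 0 ->
  (forall x z, e x z -> f x <= (f z).+1) ->
  (forall x, x != y -> exists2 z, e x z & f x = (f z).+1) ->
  forall x, gdist e x y = f x.
Proof.
move=> fy0 f_lip f_descent x.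
have f_le p : forall z, path e z p -> last z p = y -> f z <= size p.
  elim: p => [|t p IHp] z /=; first by move=> _ ->; rewrite fy0.
  by case/andP=> ezt ep lp; apply: leq_trans (f_lip _ _ ezt) _; apply: IHp.
have [p [ep lp] szp] : exists2 p, path e x p /\ last x p = y & size p = f x.
  have [n] := ubnP (f x); elim: n x => // n IHn x ltxn.
  have [->|xy] := eqVneq x y; first by exists [::]; rewrite ?fy0.
  have [z exz fx] := f_descent x xy.
  have [|p [ep lp] szp] := IHn z; first by rewrite -ltnS -fx.
  by exists (z :: p); rewrite /= ?exz ?szp.
apply/eqP; rewrite eqn_leq -{1}szp gdist_le_walk //=.
(* The walk [p] shows connectedness, so [gdist e x y] is the length of an actual walk. *)
have [|q [eq lq] <-] := @gdist_walk T e x y; last exact: f_le.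
by apply/connectP; exists p.
Qed.

Definition vertex (a b c d : bool) : FCN_vertex 1 := [tuple a; b; c; d].

Lemma vertexP (x : FCN_vertex 1) : exists a b c d, x = vertex a b c d.
Proof.
case: x => [[|a [|b [|c [|d [|? ?]]]]] sz] //.
by exists a, b, c, d; apply: val_inj.
Qed.

Definition vertices : seq (FCN_vertex 1) :=
  let bb := [seq (a, b) | a <- [:: false; true], b <- [:: false; true]] in
  [seq vertex p.1 p.2 q.1 q.2 | p <- bb, q <- bb].

Lemma mem_vertices (x : FCN_vertex 1) : x \in vertices.
Proof. by case: (vertexP x) => -[] [[] [[] [[] ->]]]; vm_compute. Qed.

Definition hamming (u v : seq bool) : nat :=
  count (fun p => p.1 != p.2) (zip u v).

(* FCN(0) is the square {0,1}^2 with its Hamming distance, and a path between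
   two copies runs through their attaching vertices. *)
Definition fcn1_dist (u v : seq bool) : nat :=
  if take 2 u == take 2 v then hamming (drop 2 u) (drop 2 v)
  else hamming (drop 2 u) (junction 1) + hamming (take 2 u) (take 2 v)
       + hamming (drop 2 v) (junction 1).

(** The hypotheses of [gdist_eq] become finite checks over the 16 vertices. *)
Lemma gdist_FCN1 (x y : FCN_vertex 1) : gdist (@FCN 1) x y = fcn1_dist x y.
Proof.
apply: (@gdist_eq _ (@FCN 1) y (fun z : FCN_vertex 1 => fcn1_dist z y)).
- have /allP/(_ y (mem_vertices y))/eqP-> // :
    all (fun v : FCN_vertex 1 => fcn1_dist v v == 0) vertices by vm_compute.
- have /allP/(_ y (mem_vertices y))/allP H :
    all (fun v : FCN_vertex 1 => all (fun u : FCN_vertex 1 =>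
      all (fun t : FCN_vertex 1 =>
        FCN 1 u t ==> (fcn1_dist u v <= (fcn1_dist t v).+1))
      vertices) vertices) vertices by vm_compute.
  move=> u t; have /allP/(_ t (mem_vertices t))/implyP := H u (mem_vertices u).
  exact.
have /allP/(_ y (mem_vertices y))/allP H :
  all (fun v : FCN_vertex 1 => all (fun u : FCN_vertex 1 => (u != v) ==>
    has (fun t : FCN_vertex 1 =>
      FCN 1 u t && (fcn1_dist u v == (fcn1_dist t v).+1))
    vertices) vertices) vertices by vm_compute.
move=> u uy; have /implyP/(_ uy)/hasP[t _ /andP[ut /eqP]] := H u (mem_vertices u).
by exists t.
Qed.

Lemma FCN1_total_dominating_ge (D : {set FCN_vertex 1}) :
  total_dominating (@FCN 1) D -> 8 <= #|D|.
Proof.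
move=> /forallP domD.
(* [phi] records the copy and the parity inside it; it is shown to map [D] onto all 8 values. *)
pose phi (x : FCN_vertex 1) :=
  (nth false x 0, nth false x 1, nth false x 2 (+) nth false x 3).
suff -> : 8 = #|phi @: D| by apply: leq_imset_card.
suff -> : phi @: D = setT by rewrite cardsT !card_prod card_bool.
apply/setP => -[[a b] k]; rewrite inE.
(* [ab00] and [ab01] have no neighbour outside their copy, and inside a copy
   adjacent vertices have opposite parities. *)
have /existsP[y /andP[yD]] := domD (vertex a b false (~~ k)).
case: (vertexP y) yD => a' [b' [c' [d' ->]]] yD adj.
apply/imsetP; exists (vertex a' b' c' d') => //.
by move: a b k a' b' c' d' adj {yD} => [] [] [] [] [] [] [].
Qed.

Definition even_vertex (t : bool * bool * bool) : FCN_vertex 1 :=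
  vertex t.1.1 t.1.2 t.2 false.

Definition even_vertices : {set FCN_vertex 1} :=
  [set even_vertex t | t : bool * bool * bool].

Lemma card_even_vertices : #|even_vertices| <= 8.
Proof.
by apply: leq_trans (leq_imset_card _ _) _; rewrite !card_prod card_bool.
Qed.

(** Reduces an existential over a set to a search in an explicit list, which [vm_compute] can
    run. *)
Lemma even_vertices_has (P : pred (FCN_vertex 1)) :
  has P [seq x : FCN_vertex 1 <- vertices | ~~ nth false x 3] ->
  [exists y in even_vertices, P y].
Proof.
case/hasP => x; rewrite mem_filter => /andP[x3 _] Px.
apply/existsP; exists x; rewrite Px andbT.
case: (vertexP x) x3 => a [b [c [[] ->]]] // _.
by apply/imsetP; exists (a, b, c).
Qed.

Lemma even_vertices_resolving_total_dominating :
  resolving_total_dominating (@FCN 1) even_vertices.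
Proof.
apply/andP; split.
  apply/forallP => g; apply/forallP => h; apply/implyP => gh.
  apply: even_vertices_has; under eq_has do rewrite !gdist_FCN1.
  have /allP/(_ g (mem_vertices g))/allP/(_ h (mem_vertices h))/implyP :
    all (fun u : FCN_vertex 1 => all (fun v : FCN_vertex 1 => (u != v) ==>
      has (fun r : FCN_vertex 1 => fcn1_dist u r != fcn1_dist v r)
        [seq x : FCN_vertex 1 <- vertices | ~~ nth false x 3])
      vertices) vertices by vm_compute.
  exact.
apply/forallP => x; apply: even_vertices_has.
have /allP/(_ x (mem_vertices x)) // :
  all (fun u => has (FCN 1 u)
    [seq x : FCN_vertex 1 <- vertices | ~~ nth false x 3])
  vertices by vm_compute.
Qed.

Theorem theorem28 : gamma_rt (FCN 1) = 8.
Proof.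
rewrite /gamma_rt; case: arg_minnP => [|D /andP[_ domD] minD].
  (* The minimum is not a junk value: total domination by [even_vertices] gives every vertex a
     neighbour. *)
  apply: resolving_total_dominatingT => x.
  have /andP[_ /forallP/(_ x)/existsP[y /andP[_ xy]]] :=
    even_vertices_resolving_total_dominating.
  by exists y.
apply/eqP; rewrite eqn_leq FCN1_total_dominating_ge // andbT.
exact: leq_trans (minD _ even_vertices_resolving_total_dominating)
                 card_even_vertices.
Qed.
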